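(* The Lie group $(E_{6,\mathbb{R}})^{\mathbb{C}}$ is isomorphic to the Lie group $SL(3,\mathbb{C})$: $(E_{6,\mathbb{R}})^{\mathbb{C}}\cong SL(3,\mathbb{C})$.
   Context: Let $(\mathfrak{J}_{\mathbb{R}})^{\mathbb{C}}$ be the 6-dimensional complex vector space of symmetric $3\times 3$ complex matrices, and let $\det$ be the determinant on it. Define $(E_{6,\mathbb{R}})^{\mathbb{C}}=\{\alpha\in \mathrm{Iso}_{\mathbb{C}}((\mathfrak{J}_{\mathbb{R}})^{\mathbb{C}}) \mid \det(\alpha X)=\det X \text{ for all } X\}$, where $\mathrm{Iso}_{\mathbb{C}}(V)$ denotes the group of $\mathbb{C}$-linear automorphisms of the vector space $V$. *)

(* Defs.v *)
From HB Require Import structures.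
From mathcomp Require Import all_boot all_order all_algebra.
From mathcomp.real_closed Require Import complex.
From mathcomp Require Import boolp classical_sets functions reals.
From mathcomp Require Import topology normedtype derive.

Set Implicit Arguments.
Unset Strict Implicit.
Unset Printing Implicit Defensive.
Import Order.TTheory GRing.Theory Num.Theory.
Import numFieldNormedType.Exports VectorInternalTheory.

Local Open Scope classical_set_scope.
Local Open Scope ring_scope.
Local Open Scope complex_scope.

(* R[i], packed as a numClosedFieldType so that it receives the metric topology
   of MathComp-Analysis. *)
Definition Cfield (R : realType) : numClosedFieldType := R[i].

Section ComplexLieGroups.
Context {R : realType}.
Local Notation C := (Cfield R).

(* A vectType carries no topology of its own: openness and complex
   differentiability are read in the coordinates v2r : V -> 'rV_(dim V) (with
   inverse r2v) that come with V; in finite dimension the choice of the linear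
   coordinates does not matter. *)
Definition vopen (V : vectType C) (U : set V) : Prop :=
  open ((r2v : 'rV[C]_(dim V) -> V) @^-1` U).

Definition vdifferentiable (V W : vectType C) (f : V -> W) (x : V) : Prop :=
  differentiable
    (v2r \o f \o r2v : 'rV[C]_(dim V) -> 'rV[C]_(dim W)) (v2r x).

(* Holomorphy of a map on an arbitrary subset A of a vector space: near each
   point of A, the map is the restriction of a map that is complex
   differentiable on an open set. When A is an embedded complex submanifold,
   this is holomorphy for the induced complex structure. *)
Definition holomorphic_on (V W : vectType C) (A : set V) (f : V -> W) : Prop :=
  forall x, A x -> exists (U : set V) (g : V -> W),
    [/\ vopen U, U x, forall y, U y -> vdifferentiable g y
      & forall y, A y -> U y -> f y = g y].

Definition biholomorphism (V W : vectType C) (A : set V) (B : set W)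
    (f : V -> W) (g : W -> V) : Prop :=
  [/\ [/\ (forall x, A x -> B (f x)) & (forall y, B y -> A (g y))],
      [/\ (forall x, A x -> g (f x) = x) & (forall y, B y -> f (g y) = y)],
      holomorphic_on A f
    & holomorphic_on B g].

(* Embedded complex submanifold: locally biholomorphic to an open subset of
   C^k. *)
Definition complex_submanifold (V : vectType C) (M : set V) : Prop :=
  exists k : nat, forall x, M x ->
    exists (U : set V) (O : set 'rV[C]_k) (c : V -> 'rV[C]_k)
           (p : 'rV[C]_k -> V),
      [/\ vopen U, U x, vopen O & biholomorphism (M `&` U) O c p].

(* A complex Lie group realized on a subset of a finite-dimensional complex
   vector space; the operations are only meaningful on the carrier. *)
Record lie_data := LieData {
  lie_space : vectType C;
  lie_carrier : set lie_space;
  lie_mul : lie_space -> lie_space -> lie_space;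
  lie_one : lie_space;
  lie_inv : lie_space -> lie_space }.

Definition group_on (G : lie_data) : Prop :=
  let A := @lie_carrier G in let mul := @lie_mul G in
  let e := lie_one G in let inv := @lie_inv G in
  [/\ [/\ A e, (forall x y, A x -> A y -> A (mul x y))
        & (forall x, A x -> A (inv x))],
      (forall x y z, A x -> A y -> A z -> mul x (mul y z) = mul (mul x y) z),
      (forall x, A x -> mul e x = x /\ mul x e = x)
    & (forall x, A x -> mul (inv x) x = e /\ mul x (inv x) = e)].

Definition is_lie_group (G : lie_data) : Prop :=
  [/\ group_on G,
      complex_submanifold (@lie_carrier G),
      @holomorphic_on (lie_space G * lie_space G)%type (lie_space G)
        (@lie_carrier G `*` @lie_carrier G) (fun xy => lie_mul xy.1 xy.2)
    & holomorphic_on (@lie_carrier G) (@lie_inv G)].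

Definition lie_isomorphic (G H : lie_data) : Prop :=
  exists (f : lie_space G -> lie_space H) (g : lie_space H -> lie_space G),
    biholomorphism (@lie_carrier G) (@lie_carrier H) f g /\
    (forall x y, lie_carrier x -> lie_carrier y ->
       f (lie_mul x y) = lie_mul (f x) (f y)).

End ComplexLieGroups.

Section Groups.
Variable R : realType.
Local Notation C := (Cfield R).

Definition sym3 : {vspace 'M[C]_3} :=
  fixedSpace (linfun (trmx : 'M[C]_3 -> 'M[C]_3)).

Lemma mem_sym3 (X : 'M[C]_3) : (X \in sym3) = (X^T == X).
Proof. by rewrite /sym3 (sameP fixedSpaceP eqP) lfunE. Qed.

Definition jordanC : vectType C := subvs_of sym3.

Definition detJ (X : jordanC) : C := \det (vsval X : 'M[C]_3).

Definition E6RC : lie_data := {|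
  lie_space := 'End(jordanC);
  lie_carrier := [set alpha : 'End(jordanC) |
    bijective alpha /\ forall X : jordanC, detJ (alpha X) = detJ X];
  lie_mul := fun alpha beta => (alpha \o beta)%VF;
  lie_one := \1%VF;
  lie_inv := fun alpha => (alpha^-1)%VF |}.

Definition SL3C : lie_data := {|
  lie_space := 'M[C]_3;
  lie_carrier := [set A : 'M[C]_3 | \det A = 1];
  lie_mul := fun A B => A *m B;
  lie_one := 1%:M;
  lie_inv := @invmx C 3 |}.

End Groups.

(* Main.v *)
Require Import Defs.
From HB Require Import structures.
From mathcomp Require Import all_boot all_order all_algebra reals.
From mathcomp.real_closed Require Import complex.
From mathcomp Require Import boolp classical_sets functions.
From mathcomp Require Import topology normedtype derive.
From mathcomp Require Import ring.

(** The isomorphism SL(3,C) -> (E_{6,R})^C sends A to the congruence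
    X |-> A X A^T.

    Surjectivity: det (Y + t X) has t^2-coefficient tr (Y adj X), so a linear
    bijection of the symmetric matrices preserving det preserves the symmetric
    matrices with adj X = 0, which over C are the squares w w^T. The images
    w_i w_i^T of the matrices E_ii assemble into a matrix W with det W = +-1;
    after composing with the congruence by W^-1 one may assume that each E_ii is
    fixed. The rank one pencils (e_i + t e_j) (e_i + t e_j)^T then force
    E_ij + E_ji to be sent to +-(E_ij + E_ji), and det J = 0 for the all-ones
    matrix J shows that the three signs are those of a congruence by a diagonal
    matrix. As the dimension is odd, A or -A has determinant 1.

    Holomorphy of the inverse: where A_ki is nonzero, A_ki A is a rational
    function of the congruence by A, and det A = 1 recovers A from it rationally.

    SL(3,C) is a submanifold because near a point with nonzero (i,j)-cofactor
    the equation det = 1 can be solved for the (i,j) entry; all of the structure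
    on (E_{6,R})^C is transported along the biholomorphism. *)

Set Implicit Arguments.
Unset Strict Implicit.
Unset Printing Implicit Defensive.
Import Order.TTheory GRing.Theory Num.Theory.
Import numFieldNormedType.Exports VectorInternalTheory.
Local Open Scope classical_set_scope.
Local Open Scope ring_scope.

(** * Explicit formulas for indices and matrices of size three *)

Lemma ord3P (i : 'I_3) : [\/ i = 0, i = 1 | i = 2%:R].
Proof.
by case: i => [[|[|[|]]]] // ?; [apply: Or31|apply: Or32|apply: Or33];
  apply: val_inj.
Qed.

Lemma sum_ord3 (V : nmodType) (F : 'I_3 -> V) : \sum_i F i = F 0 + F 1 + F 2%:R.
Proof.
by rewrite !big_ord_recl big_ord0 addr0 addrA; congr (_ + F _ + F _); apply: val_inj.
Qed.

Lemma det_mx33 (K : comNzRingType) (M : 'M[K]_3) :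
  \det M = M 0 0 * (M 1 1 * M 2%:R 2%:R - M 1 2%:R * M 2%:R 1)
         - M 0 1 * (M 1 0 * M 2%:R 2%:R - M 1 2%:R * M 2%:R 0)
         + M 0 2%:R * (M 1 0 * M 2%:R 1 - M 1 1 * M 2%:R 0).
Proof.
(* Indexing the entries by natural numbers makes the many ordinal expressions of one index, built
   from [lift], compute to the same term, so that [ring] can identify them. *)
pose m (a b : nat) := M (inord a) (inord b).
have E (a b : 'I_3) : M a b = m a b by rewrite /m !inord_val.
rewrite (expand_det_row _ 0) !big_ord_recl big_ord0 /cofactor.
rewrite !(expand_det_row _ 0) !big_ord_recl !big_ord0 /cofactor !det_mx11 !mxE /=.
by rewrite !E /= /bump /= !addn0 !add1n !expr0 !expr1 -signr_odd /= expr0; ring.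
Qed.

(** * Solving [\det A = 1] for one entry *)

Section EntryChart.
Variables (K : fieldType) (n : nat) (i0 j0 : 'I_n).
Local Notation k0 := (mxvec_index i0 j0).

Definition drop_entry (A : 'M[K]_n) : 'rV[K]_(n * n).-1 :=
  \row_k mxvec A 0 (lift k0 k).

Definition fill_entry (v : 'rV[K]_(n * n).-1) : 'M[K]_n :=
  vec_mx (\row_l if unlift k0 l is Some k then v 0 k else 0).

Lemma drop_entry_linear : linear drop_entry.
Proof. by move=> a A B; apply/rowP=> k; rewrite !mxE linearP !mxE. Qed.

Lemma fill_entry_linear : linear fill_entry.
Proof.
move=> a u v; rewrite /fill_entry -linearP; congr vec_mx; apply/rowP=> l.
by rewrite !mxE; case: unlift => [k|]; rewrite ?mxE // mulr0 addr0.
Qed.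

Lemma fill_entryK : cancel fill_entry drop_entry.
Proof. by move=> v; apply/rowP=> k; rewrite mxE vec_mxK mxE liftK. Qed.

Lemma drop_entryK A : fill_entry (drop_entry A) = A - A i0 j0 *: delta_mx i0 j0.
Proof.
apply: (can_inj mxvecK); rewrite vec_mxK linearB linearZ /= mxvec_delta.
apply/rowP=> l; rewrite !mxE eqxx /=; case: unliftP => [k ->|->].
  by rewrite mxE eq_sym (negPf (neq_lift _ _)) mulr0 subr0.
by rewrite mxvecE eqxx mulr1 subrr.
Qed.

Lemma drop_entry_delta : drop_entry (delta_mx i0 j0) = 0.
Proof.
by apply/rowP=> k; rewrite mxE mxvec_delta !mxE eq_sym (negPf (neq_lift _ _)).
Qed.

(** Row [i0] is deleted in the cofactor, so it does not see the modified entry. *)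
Lemma cofactor_add_delta (A : 'M[K]_n) t :
  cofactor (A + t *: delta_mx i0 j0) i0 j0 = cofactor A i0 j0.
Proof.
congr (_ * \det _); apply/matrixP=> k l; rewrite !mxE.
by rewrite [_ == i0]eq_sym (negPf (neq_lift _ _)) mulr0 addr0.
Qed.

(** By expansion along row [i0], the determinant is affine in a single entry, with the cofactor as
    slope. *)
Lemma det_add_delta (A : 'M[K]_n) t :
  \det (A + t *: delta_mx i0 j0) = \det A + t * cofactor A i0 j0.
Proof.
rewrite (expand_det_row (A + _) i0) (expand_det_row A i0).
rewrite (bigD1 j0) //= [in RHS](bigD1 j0) //=.
rewrite cofactor_add_delta !mxE !eqxx mulr1 mulrDl addrAC; congr (_ + _ + _).
apply: eq_bigr => j /negPf j_neq; rewrite !mxE eqxx j_neq mulr0 addr0.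
congr (_ * (_ * \det _)); apply/matrixP=> k l; rewrite !mxE.
by rewrite [_ == i0]eq_sym (negPf (neq_lift _ _)) mulr0 addr0.
Qed.

(** [fill_entry v] has a zero at the missing place; the added value is the root of the affine
    equation given by [det_add_delta]. It is meaningful only where the cofactor is nonzero. *)
Definition solve_entry (v : 'rV[K]_(n * n).-1) : 'M[K]_n :=
  fill_entry v + ((1 - \det (fill_entry v)) / cofactor (fill_entry v) i0 j0)
    *: delta_mx i0 j0.

End EntryChart.

(** * Linear maps preserving the determinant of symmetric matrices *)

Section DetPreservers.
Variable F : numClosedFieldType.
Implicit Types (X Y : 'M[F]_3) (w : 'cV[F]_3).

Definition symu (i j : 'I_3) : 'M[F]_3 := delta_mx i j + delta_mx j i.

Lemma tr_symu i j : (symu i j)^T = symu i j.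
Proof. by rewrite /symu raddfD /= !trmx_delta addrC. Qed.

(* The left side minus the right side is [2 * \tr (Y *m \adj X)], so for a
   symmetric [X] this says that [\adj X = 0]. *)
Definition det_affine X :=
  forall Y, Y^T = Y -> \det (Y + X) + \det (Y - X) = 2%:R * \det Y.

Lemma symE X : X^T = X -> forall i j, X i j = X j i.
Proof. by move=> sX i j; rewrite -{1}sX mxE. Qed.

(** In [\det (Y + t w w^T)] the terms of degree at least 2 in [t] vanish, as w w^T has rank at most
    one; the linear terms for [t = 1] and [t = -1] cancel. *)
Lemma det_affine_sqr w : det_affine (w *m w^T).
Proof.
move=> Y _; rewrite !det_mx33 !mxE !big_ord1 !mxE; ring.
Qed.

(** Testing [det_affine] against [symu i j] isolates one entry of the adjugate of [X]. *)
Lemma det_affine_minors X : X^T = X -> det_affine X ->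
  [/\ X 0 0 * X 1 1 = X 0 1 ^+ 2, X 0 0 * X 2%:R 2%:R = X 0 2%:R ^+ 2,
      X 1 1 * X 2%:R 2%:R = X 1 2%:R ^+ 2
    & [/\ X 0 0 * X 1 2%:R = X 0 1 * X 0 2%:R,
      X 1 1 * X 0 2%:R = X 0 1 * X 1 2%:R
    & X 2%:R 2%:R * X 0 1 = X 0 2%:R * X 1 2%:R]].
Proof.
move=> symX afX.
have [s1 s2 s3] : [/\ X 1 0 = X 0 1, X 2%:R 0 = X 0 2%:R & X 2%:R 1 = X 1 2%:R].
  by split; apply: symE.
have eq_of (a b : F) : 4%:R * (a - b) = 0 -> a = b.
  by move=> /eqP; rewrite mulf_eq0 pnatr_eq0 /= subr_eq0 => /eqP.
have tst i j := afX _ (tr_symu i j).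
(* The defect [2 * \tr (Y *m \adj X)] is 4 times an adjugate entry for every [Y = symu i j], since
   [symu i i] is twice a matrix unit. Off-diagonal cofactors carry a minus sign, hence the [esym]
   below. *)
have fin (a b u v : F) : a = b -> 4%:R * (u - v) = a - b -> u = v.
  by move=> -> H; apply: eq_of; rewrite H subrr.
split; last split.
- by apply: fin (tst 2%:R 2%:R) _; rewrite !det_mx33 !mxE /= s1 s2 s3; ring.
- by apply: fin (tst 1 1) _; rewrite !det_mx33 !mxE /= s1 s2 s3; ring.
- by apply: fin (tst 0 0) _; rewrite !det_mx33 !mxE /= s1 s2 s3; ring.
- by apply/esym/(fin _ _ _ _ (tst 1 2%:R)); rewrite !det_mx33 !mxE /= s1 s2 s3; ring.
- by apply/esym/(fin _ _ _ _ (tst 0 2%:R)); rewrite !det_mx33 !mxE /= s1 s2 s3; ring.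
- by apply/esym/(fin _ _ _ _ (tst 0 1)); rewrite !det_mx33 !mxE /= s1 s2 s3; ring.
Qed.

Lemma eq_sym33 X Y : X^T = X -> Y^T = Y ->
  X 0 0 = Y 0 0 -> X 0 1 = Y 0 1 -> X 0 2%:R = Y 0 2%:R ->
  X 1 1 = Y 1 1 -> X 1 2%:R = Y 1 2%:R -> X 2%:R 2%:R = Y 2%:R 2%:R -> X = Y.
Proof.
move=> /symE sX /symE sY h00 h01 h02 h11 h12 h22; apply/matrixP=> i j.
by case: (ord3P i) (ord3P j) => -> [] -> //; rewrite sX sY.
Qed.

Lemma det_affine_rank1 X : X^T = X -> det_affine X ->
  exists w, X = w *m w^T.
Proof.
move=> symX /(det_affine_minors symX)[e01 e02 e12 [f0 f1 f2]].
have [s1 s2 s3] : [/\ X 1 0 = X 0 1, X 2%:R 0 = X 0 2%:R & X 2%:R 1 = X 1 2%:R].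
  by split; apply: symE.
(* If [X] is the square of [w], then row [i] of [X] is [w_i] times [w^T] and [X i i] is [w_i ^+ 2]:
   dividing the row by a square root of the pivot gives [w] up to sign. *)
have pivot i : X i i != 0 -> (forall k l, X i i * X k l = X i k * X i l) ->
    exists w, X = w *m w^T.
  move=> nz h; exists (\col_k (X i k / sqrtC (X i i))); apply/matrixP=> k l.
  rewrite !mxE big_ord1 !mxE mulrACA -h -invfM -expr2 sqrtCK mulrAC divff ?mul1r //.
have [z0|] := eqVneq (X 0 0) 0; last first.
  move/pivot; apply=> k l.
  by case: (ord3P k) (ord3P l) => -> [] ->; rewrite ?s1 ?s2 ?s3 ?e01 ?e02 ?f0; ring.
have [z1|] := eqVneq (X 1 1) 0; last first.
  move/pivot; apply=> k l.
  by case: (ord3P k) (ord3P l) => -> [] ->;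
    rewrite ?s1 ?s2 ?s3 ?(mulrC (X 1 1) (X 0 0)) ?e01 ?e12 ?f1; ring.
have [z2|] := eqVneq (X 2%:R 2%:R) 0; last first.
  move/pivot; apply=> k l.
  by case: (ord3P k) (ord3P l) => -> [] ->;
    rewrite ?s1 ?s2 ?s3 ?(mulrC (X 2%:R 2%:R) (X 0 0))
      ?(mulrC (X 2%:R 2%:R) (X 1 1)) ?e02 ?e12 ?f2; ring.
(* With a zero diagonal, the principal minors kill the off-diagonal entries, so [X = 0]. *)
have sq0 (a : F) : 0 = a ^+ 2 -> a = 0 by move/esym/eqP; rewrite sqrf_eq0 => /eqP.
move: e01 e02 e12; rewrite z0 z1 z2 !mul0r => /sq0 h01 /sq0 h02 /sq0 h12.
by exists 0; rewrite mul0mx; apply: eq_sym33; rewrite ?mxE // linear0.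
Qed.

Lemma tr_delta_diag (i : 'I_3) : (delta_mx i i : 'M[F]_3)^T = delta_mx i i.
Proof. by rewrite trmx_delta. Qed.

Lemma sym_sum X : X^T = X ->
  X = X 0 0 *: delta_mx 0 0 + X 1 1 *: delta_mx 1 1
      + X 2%:R 2%:R *: delta_mx 2%:R 2%:R
      + X 0 1 *: symu 0 1 + X 0 2%:R *: symu 0 2%:R + X 1 2%:R *: symu 1 2%:R.
Proof.
move=> /symE sX; apply/matrixP=> i j.
case: (ord3P i) (ord3P j) => -> [] ->; rewrite !mxE /=.
all: by rewrite ?(sX 1 0) ?(sX 2%:R 0) ?(sX 2%:R 1); ring.
Qed.

(** * Pencils of rank one matrices *)

Lemma rank1_swap w i j k l : (w *m w^T) i j * (w *m w^T) k l =
  (w *m w^T) i k * (w *m w^T) j l.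
Proof. by rewrite !mxE !big_ord1 !mxE; ring. Qed.

Lemma natf_eq0 n (a : F) : n.+1%:R * a = 0 -> a = 0.
Proof. by move/eqP; rewrite mulf_eq0 pnatr_eq0 => /eqP. Qed.

Lemma sqr_eq0 (a : F) : a ^+ 2 = 0 -> a = 0.
Proof. by move/eqP; rewrite sqrf_eq0 => /eqP. Qed.

(** The right side is even in [t], so the odd part of the left side, [t * c], vanishes; then [t = 1]
    gives [s ^+ 2 = 0]. *)
Lemma linear_minor (a c s : F) :
  (forall t, (1 + t * a) * (t * c) = (t * s) ^+ 2) -> c = 0 /\ s = 0.
Proof.
move=> h; have c0 : c = 0.
  apply: (@natf_eq0 1).
  transitivity ((1 + 1 * a) * (1 * c) - (1 + -1 * a) * (-1 * c)); first by ring.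
  by rewrite !h; ring.
by split=> //; apply: sqr_eq0; rewrite -[s]mul1r -h c0; ring.
Qed.

(** The odd part [t * b + t ^+ 3 * a] of the left side vanishes for all [t], hence so do [a] and
    [b]; the coefficient of [t ^+ 2] is then [s ^+ 2]. *)
Lemma quadratic_minor (a b s : F) :
    (forall t, (1 + t * a) * (t ^+ 2 + t * b) = (t * s) ^+ 2) ->
  [/\ a = 0, b = 0 & s ^+ 2 = 1].
Proof.
move=> h; have ba : b = - a.
  apply/eqP; rewrite -subr_eq0 opprK; apply/eqP/(@natf_eq0 1).
  transitivity ((1 + 1 * a) * (1 ^+ 2 + 1 * b)
    - (1 + -1 * a) * ((-1) ^+ 2 + -1 * b)); first by ring.
  by rewrite !h; ring.
have a0 : a = 0.
  (* The value at 2 minus four times the value at 1 cancels on the right side and leaves [6 * a] on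
     the left. *)
  apply: (@natf_eq0 5); transitivity ((1 + 2%:R * a) * (2%:R ^+ 2 + 2%:R * b)
    - 4%:R * ((1 + 1 * a) * (1 ^+ 2 + 1 * b))); first by rewrite ba; ring.
  by rewrite !h; ring.
by rewrite ba a0 oppr0 -[s]mul1r -h ba a0; split=> //; ring.
Qed.

(** Each member of the pencil is a square, so its principal 2 x 2 minors vanish identically in [t].
    The minors on [{i,k}], [{j,k}] and [{i,j}] successively determine all entries of [S] up to one
    sign. *)
Lemma pencil_rank1 (S : 'M[F]_3) (i j k : 'I_3) :
    S^T = S -> i != j -> i != k -> j != k ->
    (forall t, det_affine (delta_mx i i + t *: S + t ^+ 2 *: delta_mx j j)) ->
  exists2 e, e ^+ 2 = 1 & S = e *: symu i j.
Proof.
move=> sS nij nik njk af.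
pose M t : 'M[F]_3 := delta_mx i i + t *: S + t ^+ 2 *: delta_mx j j.
have mn t a b : M t a a * M t b b = M t a b ^+ 2.
  have symM : (M t)^T = M t.
    by rewrite /M !raddfD /= !linearZ /= !trmx_delta sS.
  have [w ->] := det_affine_rank1 symM (af t).
  by rewrite rank1_swap expr2.
have nji : j != i by rewrite eq_sym.
have nki : k != i by rewrite eq_sym.
have nkj : k != j by rewrite eq_sym.
have eqs := (eqxx, negPf nij, negPf nik, negPf njk, negPf nji, negPf nki, negPf nkj).
have ME t a b : M t a b = ((a == i) && (b == i))%:R + t * S a b
    + t ^+ 2 * ((a == j) && (b == j))%:R.
  by rewrite !mxE.
have [Skk Sik] : S k k = 0 /\ S i k = 0.
  apply: (@linear_minor (S i i)) => t; have := mn t i k.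
  by rewrite !ME !eqs /= mulr1n !mulr0n !mulr0 !addr0 !add0r.
have Sjk : S j k = 0.
  apply: sqr_eq0; have := mn 1 j k.
  by rewrite !ME !eqs Skk /= !mulr0n !(mulr0, mul1r, addr0, add0r).
have [Sii Sjj Sij] : [/\ S i i = 0, S j j = 0 & S i j ^+ 2 = 1].
  apply: quadratic_minor => t; have := mn t i j.
  rewrite !ME !eqs /= !mulr1n !mulr0n !mulr0 !mulr1 !addr0 !add0r => <-.
  by congr (_ * _); rewrite addrC.
exists (S i j) => //.
have cov a : [\/ a = i, a = j | a = k].
  move: nij nik njk.
  case: (ord3P i) (ord3P j) (ord3P k) (ord3P a) => -> [] -> [] -> [] -> //;
    by [move=> *; apply: Or31|move=> *; apply: Or32|move=> *; apply: Or33].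
have Sji := symE sS j i; have Ski := symE sS k i; have Skj := symE sS k j.
apply/matrixP=> a b; case: (cov a) (cov b) => -> [] ->; rewrite !mxE !eqs /=.
all: by rewrite ?Ski ?Skj ?Sji ?Sjj ?Sii ?Skk ?Sik ?Sjk; ring.
Qed.

(** The map acts on all matrices but is constrained on symmetric ones only, so that matrix algebra
    applies without a subtype. *)
Definition det_preserver (phi : 'M[F]_3 -> 'M[F]_3) :=
  [/\ forall X, X^T = X -> (phi X)^T = phi X,
      forall Y, Y^T = Y -> exists2 X, X^T = X & phi X = Y
    & forall X, X^T = X -> \det (phi X) = \det X].

(** Every symmetric test matrix is some [phi Y], and testing [phi X] against [phi Y] amounts to
    testing [X] against [Y]. *)
Lemma det_preserver_affine (phi : {linear 'M[F]_3 -> 'M[F]_3}) X :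
  det_preserver phi -> X^T = X -> det_affine X -> det_affine (phi X).
Proof.
move=> [_ onto dphi] sX afX _ /onto[Y sY <-].
rewrite -linearD -linearB !dphi ?afX //.
  by rewrite raddfB /= sX sY.
by rewrite raddfD /= sX sY.
Qed.

Lemma det_affine_veronese (i j : 'I_3) t :
  det_affine (delta_mx i i + t *: symu i j + t ^+ 2 *: delta_mx j j).
Proof.
pose w : 'cV[F]_3 := delta_mx i 0 + t *: delta_mx j 0.
suff -> : delta_mx i i + t *: symu i j + t ^+ 2 *: delta_mx j j = w *m w^T.
  exact: det_affine_sqr.
have -> : w^T = delta_mx 0 i + t *: delta_mx 0 j.
  by rewrite /w raddfD /= linearZ /= !trmx_delta.
rewrite /w mulmxDl !mulmxDr -!scalemxAl -!scalemxAr.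
by rewrite !mul_delta_mx scalerA expr2 scalerDr !addrA.
Qed.

Lemma det_preserver_unit_sqr (phi : {linear 'M[F]_3 -> 'M[F]_3}) :
    det_preserver phi -> (forall i, phi (delta_mx i i) = delta_mx i i) ->
  exists D : 'M[F]_3, forall X, X^T = X -> phi X = D *m X *m D^T.
Proof.
move=> phiP phiE; have [sphi _ dphi] := phiP.
have sgn (i j k : 'I_3) : i != j -> i != k -> j != k ->
    exists2 e, e ^+ 2 = 1 & phi (symu i j) = e *: symu i j.
  move=> nij nik njk; apply: (pencil_rank1 (k := k)) => // [|t].
    by rewrite sphi ?tr_symu.
  rewrite -(phiE i) -(phiE j) -!linearZ -!linearD /=.
  apply: det_preserver_affine (det_affine_veronese i j t) => //.
  by rewrite !raddfD /= !linearZ /= !trmx_delta (addrC (t *: delta_mx j i)).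
have [a a1 ha] := sgn 0 1 2%:R isT isT isT.
have [b b1 hb] := sgn 0 2%:R 1 isT isT isT.
have [c c1 hc] := sgn 1 2%:R 0 isT isT isT.
have phiX X : X^T = X -> phi X =
    X 0 0 *: delta_mx 0 0 + X 1 1 *: delta_mx 1 1 + X 2%:R 2%:R *: delta_mx 2%:R 2%:R
    + (X 0 1 * a) *: symu 0 1 + (X 0 2%:R * b) *: symu 0 2%:R
    + (X 1 2%:R * c) *: symu 1 2%:R.
  move=> sX; rewrite {1}(sym_sum sX) 5!linearD !linearZ /= !phiE ha hb hc.
  by rewrite !scalerA.
(* The image of the all-ones matrix has ones on the diagonal and [a], [b], [c] off it; its
   determinant [1 + 2abc - a^2 - b^2 - c^2] must be 0. *)
have abc : a * b * c = 1.
  have sJ : (const_mx 1 : 'M[F]_3)^T = const_mx 1 by rewrite trmx_const.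
  have := dphi _ sJ; rewrite (phiX _ sJ) !det_mx33 !mxE /= => H.
  apply/eqP; rewrite -subr_eq0; apply/eqP/(@natf_eq0 1).
  transitivity (2%:R * (a * b * c - 1) - (a ^+ 2 - 1) - (b ^+ 2 - 1) - (c ^+ 2 - 1)).
    by rewrite a1 b1 c1; ring.
  by move/eqP: H; rewrite -subr_eq0 => /eqP H; rewrite -H; ring.
have cab : c = a * b.
  by rewrite -[RHS]mulr1 -c1 expr2 mulrA abc mul1r.
(* Congruence by [diag(1, a, b)] multiplies the off-diagonal entries by [a], [b] and [a * b = c],
   and fixes the diagonal because the signs square to 1. *)
exists (delta_mx 0 0 + a *: delta_mx 1 1 + b *: delta_mx 2%:R 2%:R) => X sX.
have sD : (delta_mx 0 0 + a *: delta_mx 1 1 + b *: delta_mx 2%:R 2%:R : 'M[F]_3)^T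
    = delta_mx 0 0 + a *: delta_mx 1 1 + b *: delta_mx 2%:R 2%:R.
  by rewrite !raddfD /= !linearZ /= !trmx_delta.
apply: eq_sym33; first exact: sphi.
  by rewrite !trmx_mul trmxK sX mulmxA.
all: rewrite (phiX _ sX) sD !mxE !sum_ord3 !mxE !sum_ord3 !mxE /=.
all: rewrite !(mulr0, mul0r, mulr1, addr0, add0r, mul1r) ?cab.
1-3: by [].
- by rewrite mulrAC -expr2 a1 mul1r.
- by ring.
- by rewrite mulrAC -expr2 b1 mul1r.
Qed.

Lemma mul_delta_diag (W : 'M[F]_3) i :
  W *m delta_mx i i *m W^T = col i W *m (col i W)^T.
Proof.
rewrite colE trmx_mul trmx_delta -mulmxA [RHS]mulmxA -(mulmxA W) mul_delta_mx.
by rewrite mulmxA.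
Qed.

Lemma det_preserver_congruence (phi : {linear 'M[F]_3 -> 'M[F]_3}) :
    det_preserver phi ->
  exists2 A : 'M[F]_3, \det A = 1 & forall X, X^T = X -> phi X = A *m X *m A^T.
Proof.
move=> phiP; have [sphi onto dphi] := phiP.
have phi_rank1 i : exists w, phi (delta_mx i i) = w *m w^T.
  apply: det_affine_rank1; first by rewrite sphi ?tr_delta_diag.
  apply: det_preserver_affine (tr_delta_diag i) _ => //.
  have -> : delta_mx i i = delta_mx i 0 *m (delta_mx i (0 : 'I_1))^T :> 'M[F]_3.
    by rewrite trmx_delta mul_delta_mx.
  exact: det_affine_sqr.
have /fin_all_exists[w phiE] := phi_rank1.
pose W : 'M[F]_3 := \matrix_(k, i) w i k 0.
have phiW i : phi (delta_mx i i) = W *m delta_mx i i *m W^T.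
  rewrite mul_delta_diag phiE; congr (_ *m _^T);
    by apply/matrixP=> k l; rewrite !mxE [l]ord1.
(* Summing [phiW] over [i] shows that the identity is sent to [W *m W^T]. *)
have detW : \det W ^+ 2 = 1.
  rewrite -(det1 F 3) -[in RHS]dphi ?trmx1 // expr2 -{2}(det_tr W) -det_mulmx.
  congr (\det _); rewrite mx1_sum_delta linear_sum /=.
  rewrite (eq_bigr _ (fun i _ => phiW i)).
  by rewrite -mulmx_suml -mulmx_sumr -mx1_sum_delta mulmx1.
have uW : W \in unitmx.
  by rewrite unitmxE unitfE -sqrf_eq0 detW oner_eq0.
pose V := invmx W.
have detV : \det V ^+ 2 = 1 by rewrite det_inv exprVn detW invr1.
(* Normalization: [psi] is again a determinant preserver, and it fixes the diagonal matrix units. *)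
pose psi X := V *m phi X *m V^T.
have psi_lin : linear psi.
  by move=> a X Y; rewrite /psi linearP mulmxDr mulmxDl -scalemxAr -scalemxAl.
pose psiL := GRing.isLinear.Build _ _ _ _ psi psi_lin.
pose psi' : {linear 'M[F]_3 -> 'M[F]_3} := HB.pack psi psiL.
have WVT : W^T *m V^T = 1%:M by rewrite -trmx_mul mulVmx ?trmx1.
have VWT : V^T *m W^T = 1%:M by rewrite -trmx_mul mulmxV ?trmx1.
have psiP : det_preserver psi'.
  split=> [X sX | Y sY | X sX] /=.
  - by rewrite /psi !trmx_mul trmxK (sphi _ sX) mulmxA.
  - have /onto[X sX phiX] : (W *m Y *m W^T)^T = W *m Y *m W^T.
      by rewrite !trmx_mul trmxK sY mulmxA.
    exists X => //; rewrite /psi phiX !mulmxA mulVmx // mul1mx.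
    by rewrite -mulmxA WVT mulmx1.
  - by rewrite /psi !det_mulmx det_tr dphi // mulrAC -expr2 detV mul1r.
have psiE i : psi' (delta_mx i i) = delta_mx i i.
  by rewrite /= /psi phiW !mulmxA mulVmx // mul1mx -mulmxA WVT mulmx1.
have [D psiD] := det_preserver_unit_sqr psiP psiE.
pose B := W *m D.
have phiB X : X^T = X -> phi X = B *m X *m B^T.
  move=> /psiD /= psiX; rewrite trmx_mul -!mulmxA (mulmxA D) (mulmxA (D *m X)) -psiX.
  by rewrite /psi !mulmxA mulmxV // mul1mx -mulmxA VWT mulmx1.
have : \det B ^+ 2 = 1.
  have := dphi 1%:M (trmx1 _ _).
  by rewrite phiB ?trmx1 // mulmx1 det_mulmx det_tr det1 expr2.
move/eqP; rewrite sqrf_eq1 => /orP[] /eqP detB; first by exists B.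
(* [B] and [- B] induce the same congruence, and in odd dimension their determinants are
   opposite. *)
exists (- B) => [|X sX].
  by rewrite -scaleN1r detZ detB -signr_odd expr1 mulrNN mulr1.
by rewrite phiB // raddfN /= mulNmx mulmxN mulNmx opprK.
Qed.

(** * Recovering a matrix from its congruence *)

(* If [phi] is the congruence by [A], then [phi (symu i j) k l] is
   [A k i * A l j + A k j * A l i]: the pivot matrix is [A k i *: A], and when
   [\det A = 1] its determinant [A k i ^+ 3] together with the known [A k i ^+ 2]
   determines [A k i] without a square root. *)
Definition pivot_mx (phi : 'M[F]_3 -> 'M[F]_3) (k i : 'I_3) : 'M[F]_3 :=
  \matrix_(l, j) (phi (symu i j) k l
    - phi (symu i j) k k * phi (symu i i) k l / (2%:R * phi (symu i i) k k)).

(** For the congruence by [A] with [\det A = 1], the scalar is [A k i ^+ 2 / A k i ^+ 3], which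
    undoes the factor [A k i] of the pivot matrix. *)
Definition congruence_root (phi : 'M[F]_3 -> 'M[F]_3) (k i : 'I_3) : 'M[F]_3 :=
  (phi (symu i i) k k / 2%:R / \det (pivot_mx phi k i)) *: pivot_mx phi k i.

Lemma congruence_symu (A : 'M[F]_3) i j k l :
  (A *m symu i j *m A^T) k l = A k i * A l j + A k j * A l i.
Proof.
have sdelta m n : (A *m delta_mx m n *m A^T) k l = A k m * A l n.
  rewrite -(mul_delta_mx (0 : 'I_1)) mulmxA -mulmxA -colE -rowE !mxE big_ord1.
  by rewrite !mxE.
by rewrite /symu mulmxDr mulmxDl mxE !sdelta.
Qed.

Section Recovery.
Variables (phi : 'M[F]_3 -> 'M[F]_3) (A : 'M[F]_3) (k i : 'I_3).
Hypotheses (phiE : forall X, X^T = X -> phi X = A *m X *m A^T) (Aki : A k i != 0).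

Lemma congruence_pivot : phi (symu i i) k k = 2%:R * A k i ^+ 2.
Proof. by rewrite phiE ?tr_symu // congruence_symu; ring. Qed.

(** The quotient subtracted in [pivot_mx] simplifies to [A k j * A l i], leaving [A k i * A l j]. *)
Lemma pivot_mxE : pivot_mx phi k i = A k i *: A.
Proof.
apply/matrixP=> l j; rewrite !mxE !phiE ?tr_symu // !congruence_symu.
by field; rewrite -mulr2n mulrn_eq0 /= mulf_neq0.
Qed.

Lemma congruence_rootE : \det A = 1 -> congruence_root phi k i = A.
Proof.
move=> detA; rewrite /congruence_root congruence_pivot pivot_mxE detZ detA scalerA.
by rewrite -[RHS]scale1r; congr (_ *: _); field.
Qed.

End Recovery.

Lemma det1_neq0_entry (A : 'M[F]_3) : \det A = 1 -> exists k i, A k i != 0.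
Proof.
move=> detA; case: (pickP (fun ki : 'I_3 * 'I_3 => A ki.1 ki.2 != 0)) => [ki|A0].
  by exists ki.1, ki.2.
move: (oner_eq0 F); rewrite -detA; suff -> : A = 0 by rewrite det0 eqxx.
by apply/matrixP=> k i; have /negbFE/eqP := A0 (k, i); rewrite mxE.
Qed.

End DetPreservers.

(** * Complex differentiability in coordinates *)

Section Holomorphy.
Variable R : realType.
Local Notation C := (Cfield R).
Implicit Types U V W : vectType C.

(* [C] itself is not a [vectType] (only its copy [C^o] is), hence the separate
   notion for scalar functions. *)
Definition sdiff V (h : V -> C) (x : V) : Prop :=
  differentiable (h \o r2v : 'rV[C]_(dim V) -> C) (v2r x).

(** In finite dimension a linear map is a finite sum of coordinate functions times constant
    vectors. *)
Lemma rV_differentiable n (W : normedModType C) (f : {linear 'rV[C]_n -> W}) x :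
  differentiable f x.
Proof.
have -> : (f : _ -> _) =
    \sum_(i < n) (fun y : 'rV[C]_n => y ord0 i *: f (delta_mx 0 i)).
  apply/funext => y; rewrite fct_sumE {1}[y]row_sum_delta linear_sum.
  by apply: eq_bigr => i _; rewrite linearZ.
apply: differentiable_sum => i.
by apply: differentiableZl; exact: differentiable_coord.
Qed.

Lemma vdifferentiable_linear V W (f : V -> W) x : linear f -> vdifferentiable f x.
Proof.
move=> f_lin; pose g := v2r \o f \o r2v : 'rV[C]_(dim V) -> 'rV[C]_(dim W).
have g_lin : linear g by move=> a y z; rewrite /g /= linearP f_lin linearP.
pose gL := GRing.isLinear.Build _ _ _ _ g g_lin.
pose g' : {linear 'rV[C]_(dim V) -> 'rV[C]_(dim W)} := HB.pack g gL.
exact: (rV_differentiable (g' : {linear _ -> _}) (v2r x)).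
Qed.

Lemma vdifferentiable_comp V W U (f : V -> W) (g : W -> U) x :
  vdifferentiable f x -> vdifferentiable g (f x) -> vdifferentiable (g \o f) x.
Proof.
move=> df dg; rewrite /vdifferentiable.
have -> : v2r \o (g \o f) \o r2v = (v2r \o g \o r2v) \o (v2r \o f \o r2v)
    :> ('rV[C]_(dim V) -> 'rV[C]_(dim U)).
  by apply/funext => y /=; rewrite v2rK.
have e : (v2r \o f \o r2v : 'rV[C]_(dim V) -> 'rV[C]_(dim W)) (v2r x) = v2r (f x).
  by rewrite /= v2rK.
by apply: differentiable_comp; [exact: df|rewrite e; exact: dg].
Qed.

Lemma sdiff_comp V W (f : V -> W) (h : W -> C) x :
  vdifferentiable f x -> sdiff h (f x) -> sdiff (h \o f) x.
Proof.
move=> df dg; rewrite /sdiff.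
have -> : h \o f \o r2v = (h \o r2v) \o (v2r \o f \o r2v)
    :> ('rV[C]_(dim V) -> C).
  by apply/funext => y /=; rewrite v2rK.
have e : (v2r \o f \o r2v : 'rV[C]_(dim V) -> 'rV[C]_(dim W)) (v2r x) = v2r (f x).
  by rewrite /= v2rK.
by apply: differentiable_comp; [exact: df|rewrite e; exact: dg].
Qed.

Lemma sdiff_linear V (h : V -> C) x :
  linear (h : V -> C^o) -> sdiff h x.
Proof.
move=> h_lin; pose g := h \o r2v : 'rV[C]_(dim V) -> C^o.
have g_lin : linear g by move=> a y z; rewrite /g /= linearP h_lin.
pose gL := GRing.isLinear.Build _ _ _ _ g g_lin.
pose g' : {linear 'rV[C]_(dim V) -> C^o} := HB.pack g gL.
exact: (rV_differentiable (g' : {linear _ -> _}) (v2r x)).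
Qed.

Lemma sdiff_ext V (h k : V -> C) x : h =1 k -> sdiff h x -> sdiff k x.
Proof. by move/funext => ->. Qed.

Lemma sdiff_cst V (c : C) (x : V) : sdiff (fun=> c) x.
Proof. exact: differentiable_cst. Qed.

Lemma sdiffD V (h k : V -> C) x :
  sdiff h x -> sdiff k x -> sdiff (fun y => h y + k y) x.
Proof. exact: differentiableD. Qed.

Lemma sdiffN V (h : V -> C) x : sdiff h x -> sdiff (fun y => - h y) x.
Proof. exact: differentiableN. Qed.

Lemma sdiffM V (h k : V -> C) x :
  sdiff h x -> sdiff k x -> sdiff (fun y => h y * k y) x.
Proof. exact: differentiableM. Qed.

Lemma sdiffV V (h : V -> C) x :
  sdiff h x -> h x != 0 -> sdiff (fun y => (h y)^-1) x.
Proof. by move=> dh hx; apply: differentiableV => //=; rewrite v2rK. Qed.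

Lemma sdiff_sum V I (r : seq I) (h : I -> V -> C) x :
  (forall i, sdiff (h i) x) -> sdiff (fun y => \sum_(i <- r) h i y) x.
Proof.
move=> dh; elim: r => [|i r IH].
  by apply: sdiff_ext (sdiff_cst 0 x) => y; rewrite big_nil.
by apply: sdiff_ext (sdiffD (dh i) IH) => y; rewrite big_cons.
Qed.

Lemma sdiff_prod V I (r : seq I) (h : I -> V -> C) x :
  (forall i, sdiff (h i) x) -> sdiff (fun y => \prod_(i <- r) h i y) x.
Proof.
move=> dh; elim: r => [|i r IH].
  by apply: sdiff_ext (sdiff_cst 1 x) => y; rewrite big_nil.
by apply: sdiff_ext (sdiffM (dh i) IH) => y; rewrite big_cons.
Qed.

Lemma sdiff_det V n (f : V -> 'M[C]_n) x :
  (forall i j, sdiff (fun y => f y i j) x) -> sdiff (fun y => \det (f y)) x.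
Proof.
move=> df; apply: sdiff_sum => s; apply: sdiffM; first exact: sdiff_cst.
exact: sdiff_prod.
Qed.

Lemma vdifferentiableD V W (f g : V -> W) x :
  vdifferentiable f x -> vdifferentiable g x ->
  vdifferentiable (fun y => f y + g y) x.
Proof.
move=> df dg; rewrite /vdifferentiable.
have -> : v2r \o (fun y => f y + g y) \o r2v =
    (v2r \o f \o r2v) + (v2r \o g \o r2v) :> ('rV[C]_(dim V) -> 'rV[C]_(dim W)).
  by apply/funext => z; rewrite /= linearD.
exact: differentiableD.
Qed.

Lemma vdifferentiableZ V W (h : V -> C) (e : W) x :
  sdiff h x -> vdifferentiable (fun y => h y *: e) x.
Proof.
move=> dh; rewrite /vdifferentiable.
have -> : v2r \o (fun y => h y *: e) \o r2v =
    (fun z : 'rV[C]_(dim V) => (h \o r2v) z *: v2r e).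
  by apply/funext => z; rewrite /= linearZ.
exact: differentiableZl.
Qed.

Lemma vdifferentiable_cst V W (e : W) (x : V) : vdifferentiable (fun=> e) x.
Proof. exact: differentiable_cst. Qed.

Lemma vdifferentiable_sum V W I (r : seq I) (f : I -> V -> W) x :
  (forall i, vdifferentiable (f i) x) ->
  vdifferentiable (fun y => \sum_(i <- r) f i y) x.
Proof.
move=> df; elim: r => [|i r IH].
  rewrite (_ : (fun y => _) = fun=> 0); first exact: vdifferentiable_cst.
  by apply/funext => y; rewrite big_nil.
rewrite (_ : (fun y => _) = fun y => f i y + \sum_(i <- r) f i y).
  exact: vdifferentiableD.
by apply/funext => y; rewrite big_cons.
Qed.

Lemma vdifferentiable_mx V m n (f : V -> 'M[C]_(m, n)) x :
  (forall i j, sdiff (fun y => f y i j) x) -> vdifferentiable f x.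
Proof.
move=> df.
rewrite (_ : f = fun y => \sum_i \sum_j f y i j *: delta_mx i j).
  by do 2 apply: vdifferentiable_sum => ?; exact: vdifferentiableZ.
by apply/funext => y; rewrite -matrix_sum_delta.
Qed.

Lemma sdiff_entry m n i j (A : 'M[C]_(m, n)) :
  @sdiff ('M[C]_(m, n)) (fun B => B i j) A.
Proof. by apply: sdiff_linear => a B D; rewrite !mxE. Qed.

(** Writing the pair as a sum of two linear injections avoids any comparison of the coordinates of
    [W * U] with those of the factors. *)
Lemma vdifferentiable_pair V W U (f : V -> W) (g : V -> U) x :
  vdifferentiable f x -> vdifferentiable g x ->
  @vdifferentiable _ V (W * U)%type (fun y => (f y, g y)) x.
Proof.
move=> df dg.
pose inl (w : W) : (W * U)%type := (w, 0); pose inr (u : U) : (W * U)%type := (0, u).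
have inl_lin : linear inl.
  by move=> a y z; congr (_, _); rewrite /= ?scaler0 ?addr0.
have inr_lin : linear inr.
  by move=> a y z; congr (_, _); rewrite /= ?scaler0 ?addr0.
have -> : (fun y => (f y, g y)) = (fun y => (inl \o f) y + (inr \o g) y).
  by apply/funext => y; congr (_, _); rewrite /= ?addr0 ?add0r.
by apply: vdifferentiableD; apply: vdifferentiable_comp => //;
  exact: vdifferentiable_linear.
Qed.


(** * Open sets, holomorphic maps and submanifolds *)

Lemma vopenI V (U U' : set V) : vopen U -> vopen U' -> vopen (U `&` U').
Proof. exact: openI. Qed.

Lemma vopenT V : vopen [set: V].
Proof. exact: openT. Qed.

Lemma vopen_preimage V W (N : set V) (f : V -> W) (U : set W) :
  vopen N -> (forall y, N y -> vdifferentiable f y) -> vopen U ->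
  vopen (N `&` f @^-1` U).
Proof.
move=> oN df oU; rewrite /vopen openE => z [Nz Uz].
apply: filterI; first exact: open_nbhs_nbhs.
have /differentiable_continuous := df _ Nz; rewrite r2vK => fc.
have : nbhs z ((v2r \o f \o r2v : 'rV[C]_(dim V) -> 'rV[C]_(dim W)) @^-1`
    ((r2v : 'rV[C]_(dim W) -> W) @^-1` U)).
  by apply: fc; apply: open_nbhs_nbhs; split=> //=; rewrite v2rK.
by apply: filterS => t /=; rewrite v2rK.
Qed.

Lemma vopen_local V (A : set V) :
  (forall x, A x -> exists U : set V, [/\ vopen U, U x & U `<=` A]) -> vopen A.
Proof.
move=> loc; rewrite /vopen openE => z /loc[U [oU Uz UA]].
have : nbhs z ((r2v : 'rV[C]_(dim V) -> V) @^-1` U) by exact: open_nbhs_nbhs.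
by apply: filterS => t; exact: UA.
Qed.

Lemma vopen_neq0 V (N : set V) (h : V -> C) :
  vopen N -> (forall y, N y -> sdiff h y) ->
  vopen (N `&` [set y | h y != 0]).
Proof.
move=> oN dh; rewrite /vopen openE => z [Nz hz].
apply: filterI; first exact: open_nbhs_nbhs.
have /differentiable_continuous := dh _ Nz; rewrite r2vK => hc.
by have := cvgr_neq0 _ hc hz; exact.
Qed.

Lemma holomorphic_on_diff V W (A : set V) (f : V -> W) :
  (forall x, vdifferentiable f x) -> holomorphic_on A f.
Proof. by move=> df x Ax; exists setT, f; split=> //; exact: vopenT. Qed.

Lemma holomorphic_on_eq V W (A : set V) (f g : V -> W) :
  (forall x, A x -> f x = g x) -> holomorphic_on A f -> holomorphic_on A g.
Proof.
move=> fg hf x /hf[U [h [oU Ux dh fh]]]; exists U, h; split=> // y Ay Uy.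
by rewrite -fg ?fh.
Qed.

Lemma holomorphic_on_sub V W (A B : set V) (f : V -> W) :
  A `<=` B -> holomorphic_on B f -> holomorphic_on A f.
Proof.
move=> AB hf x /AB/hf[U [h [oU Ux dh fh]]]; exists U, h; split=> // y /AB.
exact: fh.
Qed.

Lemma holomorphic_on_comp V W U (A : set V) (B : set W) (f : V -> W) (g : W -> U) :
  (forall x, A x -> B (f x)) -> holomorphic_on A f -> holomorphic_on B g ->
  holomorphic_on A (g \o f).
Proof.
move=> AB hf hg x Ax.
have [N [f' [oN Nx df' ff']]] := hf _ Ax.
have [M [g' [oM Mx dg' gg']]] := hg _ (AB _ Ax).
(* The local extension of [f] is restricted to the points that it sends into the domain of the local
   extension of [g]. *)
exists (N `&` f' @^-1` M), (g' \o f'); split.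
- exact: vopen_preimage.
- by split=> //=; rewrite -ff'.
- by move=> y [Ny My]; apply: vdifferentiable_comp; [exact: df'|exact: dg'].
- by move=> y Ay [Ny /= My]; rewrite ff' // gg' // -ff' //; exact: AB.
Qed.

Lemma holomorphic_on_pair V W U (A : set V) (f : V -> W) (g : V -> U) :
  holomorphic_on A f -> holomorphic_on A g ->
  @holomorphic_on _ V (W * U)%type A (fun y => (f y, g y)).
Proof.
move=> hf hg x Ax.
have [N [f' [oN Nx df' ff']]] := hf _ Ax.
have [M [g' [oM Mx dg' gg']]] := hg _ Ax.
exists (N `&` M), (fun y => (f' y, g' y)); split=> //; first exact: vopenI.
  by move=> y [Ny My]; apply: vdifferentiable_pair; [exact: df'|exact: dg'].
by move=> y Ay [Ny My]; rewrite ff' // gg'.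
Qed.

Lemma biholomorphism_sym V W (A : set V) (B : set W) f g :
  biholomorphism A B f g -> biholomorphism B A g f.
Proof. by case=> -[fA gB] [fK gK] hf hg. Qed.

(** Near each point [f] agrees on the open set [O] with a differentiable extension, whose preimages
    are open. *)
Lemma vopen_preimage_holomorphic V W (O : set V) (f : V -> W) (U : set W) :
  vopen O -> holomorphic_on O f -> vopen U -> vopen (O `&` f @^-1` U).
Proof.
move=> oO hf oU; apply: vopen_local => x [Ox Ux].
have [N [g [oN Nx dg fg]]] := hf _ Ox.
exists ((O `&` N) `&` g @^-1` U); split.
- by apply: vopen_preimage => // [|y [_ /dg]//]; exact: vopenI.
- by split=> //=; rewrite -fg.
- by move=> y [[Oy Ny] /= Uy]; split=> //=; rewrite fg.
Qed.

Lemma submanifold_biholomorphism V W (A : set V) (B : set W) f g :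
  biholomorphism A B f g -> complex_submanifold A -> complex_submanifold B.
Proof.
move=> [[fA gB] [fK gK] hf hg] [k chart]; exists k => y By.
have [U [O [c [p [oU Ugy oO [[cA pO] [cK pK] hc hp]]]]]] := chart _ (gB _ By).
have [N [g' [oN Ny dg' gg']]] := hg _ By.
have gM z : (B `&` (N `&` g' @^-1` U)) z -> (A `&` U) (g z).
  by move=> [Bz [Nz Uz]]; split; [exact: gB|rewrite gg'].
have pA v : O v -> A (p v) by move=> /pO[].
have hfp : holomorphic_on O (f \o p) by exact: holomorphic_on_comp pA hp hf.
(* The chart of [A] at [g y] is carried over by [f] and [g]. The ambient neighbourhood comes from
   the extension [g'], as [g] is controlled on [B] only; [O] shrinks to the parameters whose image
   lies in [N]. *)
exists (N `&` g' @^-1` U), (O `&` (f \o p) @^-1` N), (c \o g), (f \o p); split=> //.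
- exact: vopen_preimage.
- by split=> //=; rewrite -gg'.
- exact: vopen_preimage_holomorphic.
split.
- split=> [z Mz|v [Ov Nv]].
    split=> /=; first exact/cA/gM.
    by rewrite cK ?gK; [case: Mz => ? []|case: Mz|exact: gM].
  have [Ap Up] := pO _ Ov; split; first exact: fA.
  by split=> //=; rewrite -gg' ?fK //; exact: fA.
- split=> [z Mz|v [Ov Nv]] /=; first by rewrite cK ?gK; [|case: Mz|exact: gM].
  by rewrite fK ?pK //; exact: pA.
- by apply: holomorphic_on_comp gM _ hc; apply: holomorphic_on_sub hg => z [].
- by apply: holomorphic_on_sub hfp => v [].
Qed.

(** * Transport of a Lie group structure *)

Section Transport.
Variables (G H : @lie_data R).
Variables (f : lie_space G -> lie_space H) (g : lie_space H -> lie_space G).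
Hypotheses (fg : biholomorphism (@lie_carrier _ G) (@lie_carrier _ H) f g)
  (fM : forall x y, lie_carrier x -> lie_carrier y ->
    f (lie_mul x y) = lie_mul (f x) (f y)).

(** On the carrier of [H], the operations are those of [G] conjugated by [f] and [g], hence
    composites of holomorphic maps. *)
Lemma lie_group_biholomorphism : is_lie_group G -> group_on H -> is_lie_group H.
Proof.
move=> [Ggrp Gman mulG invG] Hgrp; have [[fA gB] [fK gK] hf hg] := fg.
have [[Ge GM GV] GA G1 GVK] := Ggrp; have [[He HM HV] HA H1 HVK] := Hgrp.
have fV x : lie_carrier x -> f (lie_inv x) = lie_inv (f x).
  move=> Ax; have Bx := fA _ Ax; have BVx := fA _ (GV _ Ax).
  have fe : f (lie_one G) = lie_one H.
    have Bfe := fA _ Ge.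
    (* The image of the unit is idempotent, and an idempotent of a group is its unit. *)
    have fee : lie_mul (f (lie_one G)) (f (lie_one G)) = f (lie_one G).
      by rewrite -fM // (G1 _ Ge).1.
    rewrite -(HVK _ Bfe).1 -{3}fee (HA _ _ _ (HV _ Bfe) Bfe Bfe).
    by rewrite (HVK _ Bfe).1 (H1 _ Bfe).1.
  rewrite -(H1 _ BVx).1 -(HVK _ Bx).1 -(HA _ _ _ (HV _ Bx) Bx BVx).
  by rewrite -(fM Ax (GV _ Ax)) (GVK _ Ax).2 fe (H1 _ (HV _ Bx)).2.
split=> //.
- exact: submanifold_biholomorphism fg Gman.
- apply: (@holomorphic_on_eq _ _ _ (f \o (fun xy => lie_mul xy.1 xy.2)
      \o (fun xy : lie_space H * lie_space H => (g xy.1, g xy.2)))).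
    by move=> [x y] [/= Bx By]; rewrite fM ?gK //; exact: gB.
  apply: (holomorphic_on_comp (B := @lie_carrier _ G `*` @lie_carrier _ G)).
  + by move=> [x y] [/= Bx By]; split; exact: gB.
  + apply: holomorphic_on_pair.
      apply: (holomorphic_on_comp (B := @lie_carrier _ H)) hg; first by move=> ? [].
      apply: holomorphic_on_diff => xy.
      exact: vdifferentiable_linear.
    apply: (holomorphic_on_comp (B := @lie_carrier _ H)) hg; first by move=> ? [].
    apply: holomorphic_on_diff => xy.
    exact: vdifferentiable_linear.
  + by apply: holomorphic_on_comp mulG hf => -[x y] [/= Ax Ay]; exact: GM.
- apply: (@holomorphic_on_eq _ _ _ (f \o (@lie_inv _ G) \o g)).
    by move=> y By; rewrite /= fV ?gK //; exact: gB.
  apply: (holomorphic_on_comp (B := @lie_carrier _ G)) => //.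
  exact: holomorphic_on_comp invG hf.
Qed.

End Transport.
End Holomorphy.

(** * The special linear group *)

Section SpecialLinear.
Variables (R : realType) (n : nat).
Local Notation C := (Cfield R).

Definition SLset : set 'M[C]_n := [set A | \det A = 1].

Lemma sdiff_cofactor (i j : 'I_n) (A : 'M[C]_n) :
  @sdiff R 'M[C]_n (fun B => cofactor B i j) A.
Proof.
apply: sdiffM; first exact: sdiff_cst.
apply: sdiff_det => k l.
by apply: sdiff_ext (sdiff_entry (lift i k) (lift j l) A) => B; rewrite !mxE.
Qed.

Lemma holomorphic_mulmx (A : set ('M[C]_n * 'M[C]_n)%type) :
  @holomorphic_on R ('M[C]_n * 'M[C]_n)%type 'M[C]_n A (fun xy => xy.1 *m xy.2).
Proof.
apply: holomorphic_on_diff => xy; apply: vdifferentiable_mx => i j.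
apply: (@sdiff_ext _ _
  (fun z : ('M[C]_n * 'M[C]_n)%type => \sum_k z.1 i k * z.2 k j)).
  by move=> z; rewrite mxE.
apply: sdiff_sum => k; apply: sdiffM.
  by apply: sdiff_linear => a x y; rewrite /= !mxE.
by apply: sdiff_linear => a x y; rewrite /= !mxE.
Qed.

Lemma holomorphic_invmx : @holomorphic_on R 'M[C]_n 'M[C]_n SLset (@invmx C n).
Proof.
(* Where the determinant is 1, the inverse is the adjugate, which is polynomial on the whole
   space. *)
apply: (@holomorphic_on_eq _ _ _ _ (fun A => \adj A)).
  by move=> A detA; rewrite /invmx unitmxE detA unitr1 invr1 scale1r.
apply: holomorphic_on_diff => A; apply: vdifferentiable_mx => i j.
by apply: sdiff_ext (sdiff_cofactor j i A) => B; rewrite mxE.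
Qed.

End SpecialLinear.

(** * Charts of the special linear group *)

Section Chart.
Variables (R : realType) (n : nat) (i0 j0 : 'I_n).
Local Notation C := (Cfield R).
Local Notation drop_entry := (drop_entry (K := C) i0 j0).
Local Notation fill_entry := (fill_entry (K := C) i0 j0).
Local Notation solve_entry := (solve_entry (K := C) i0 j0).

Lemma sdiff_fill_cofactor v :
  @sdiff R 'rV[C]_(n * n).-1 (fun u => cofactor (fill_entry u) i0 j0) v.
Proof.
apply: (sdiff_comp _ (sdiff_cofactor i0 j0 _)).
exact/vdifferentiable_linear/fill_entry_linear.
Qed.

Lemma vopen_cofactor : @vopen R 'M[C]_n [set A | cofactor A i0 j0 != 0].
Proof.
rewrite -[X in vopen X]setTI; apply: vopen_neq0; first exact: vopenT.
by move=> A _; exact: sdiff_cofactor.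
Qed.

Lemma vopen_fill_cofactor :
  @vopen R 'rV[C]_(n * n).-1 [set v | cofactor (fill_entry v) i0 j0 != 0].
Proof.
rewrite -[X in vopen X]setTI; apply: vopen_neq0; first exact: vopenT.
by move=> v _; exact: sdiff_fill_cofactor.
Qed.

(** The cofactor does not depend on the dropped entry, so its nonvanishing can be read in the chart;
    there the dropped entry is a rational function of the others. *)
Lemma SL_chart : @biholomorphism R 'M[C]_n 'rV[C]_(n * n).-1
  (@SLset R n `&` [set A | cofactor A i0 j0 != 0])
  [set v | cofactor (fill_entry v) i0 j0 != 0] drop_entry solve_entry.
Proof.
have cofK A : cofactor (fill_entry (drop_entry A)) i0 j0 = cofactor A i0 j0.
  by rewrite drop_entryK -scaleNr cofactor_add_delta.
have dfill x : @vdifferentiable R _ _ fill_entry x.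
  exact/vdifferentiable_linear/fill_entry_linear.
split; first split.
- by move=> A [_ /= cA]; rewrite cofK.
- move=> v /= cv; split=> /=; last by rewrite cofactor_add_delta.
  by rewrite /SLset /= det_add_delta divfK // addrC subrK.
- split=> [A [/= detA cA]|v _].
    rewrite /solve_entry cofK drop_entryK -scaleNr det_add_delta detA.
    by rewrite mulNr opprB subrKC mulfK // scaleNr subrK.
  rewrite /solve_entry addrC drop_entry_linear.
  by rewrite drop_entry_delta scaler0 add0r fill_entryK.
- apply: holomorphic_on_diff => A.
  exact/vdifferentiable_linear/drop_entry_linear.
- move=> v Ov; exists [set v | cofactor (fill_entry v) i0 j0 != 0], solve_entry.
  split=> //; first exact: vopen_fill_cofactor.
  move=> u cu; have dcof := sdiff_fill_cofactor u.
  apply: vdifferentiableD => //; apply: vdifferentiableZ; apply: sdiffM.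
    apply: sdiffD; first exact: sdiff_cst.
    apply/sdiffN/sdiff_det => i j.
    exact: (sdiff_comp (dfill u) (sdiff_entry i j _)).
  exact: sdiffV.
Qed.

End Chart.

Lemma SL_submanifold (R : realType) (n : nat) : complex_submanifold (@SLset R n.+1).
Proof.
exists (n.+1 * n.+1).-1 => A detA.
(* If all cofactors of the first row vanished, expansion along that row would give determinant 0. *)
have [j cA] : exists j, cofactor A ord0 j != 0.
  case: (pickP (fun j => cofactor A ord0 j != 0)) => [j cj|c0]; first by exists j.
  move: (oner_eq0 (Cfield R)); rewrite -[X in X == 0]detA (expand_det_row _ ord0).
  rewrite big1 ?eqxx // => j _; have /negbFE/eqP -> := c0 j; exact: mulr0.
exists [set A | cofactor A ord0 j != 0].
exists [set v | cofactor (fill_entry (K := Cfield R) ord0 j v) ord0 j != 0].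
exists (drop_entry ord0 j), (solve_entry ord0 j).
split; [exact: vopen_cofactor|exact: cA|exact: vopen_fill_cofactor|exact: SL_chart].
Qed.

Lemma SL3C_group (R : realType) : group_on (SL3C R).
Proof.
have uA (A : 'M[Cfield R]_3) : \det A = 1 -> A \in unitmx.
  by move=> detA; rewrite unitmxE detA unitr1.
split=> /=.
- split=> [|A B dA dB|A dA]; first exact: det1.
    by rewrite det_mulmx dA dB mulr1.
  by rewrite det_inv dA invr1.
- by move=> *; exact: mulmxA.
- by move=> A _; rewrite mul1mx mulmx1.
- by move=> A /uA uA'; rewrite mulVmx // mulmxV.
Qed.

Lemma SL3C_lie (R : realType) : is_lie_group (SL3C R).
Proof.
split; [exact: SL3C_group|exact: SL_submanifold|exact: holomorphic_mulmx|].
exact: holomorphic_invmx.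
Qed.

(** * Congruences *)

Section Congruence.
Variable R : realType.
Local Notation C := (Cfield R).
Local Notation J := (jordanC R).
Local Notation proj := (vsproj (sym3 R)).
Implicit Types (A B : 'M[C]_3) (alpha beta : 'End(J)).

Lemma tr_vsval (X : J) : (vsval X)^T = vsval X.
Proof. by apply/eqP; rewrite -mem_sym3; exact: subvsP. Qed.

Lemma projK (X : 'M[C]_3) : X^T = X -> vsval (proj X) = X.
Proof. by move=> sX; apply: vsprojK; rewrite mem_sym3 sX. Qed.

(** Two independent matrices make the construction bilinear, which yields holomorphy of the
    congruence in [A]. For [A = B] the product is already symmetric and [proj] leaves it
    unchanged. *)
Definition cong_fun A B (X : J) : J := proj (A *m vsval X *m B^T).

Lemma cong_fun_linear A B : linear (cong_fun A B).
Proof.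
move=> a X Y; rewrite /cong_fun -[RHS]linearP; congr proj.
have -> : vsval (a *: X + Y) = a *: vsval X + vsval Y by exact: linearP.
by rewrite mulmxDr mulmxDl -scalemxAr -scalemxAl.
Qed.

HB.instance Definition _ A B :=
  GRing.isLinear.Build C J J *:%R (cong_fun A B) (cong_fun_linear A B).

Definition cong2 A B : 'End(J) := linfun (cong_fun A B).

Lemma vsval_cong A X : vsval (cong2 A A X) = A *m vsval X *m A^T.
Proof. by rewrite lfunE projK // !trmx_mul trmxK tr_vsval mulmxA. Qed.

(** By bilinearity, the congruence by [A] is a quadratic polynomial in the entries of [A] with
    constant endomorphisms as coefficients. *)
Lemma cong2_sum A B : cong2 A B =
  \sum_i \sum_j \sum_k \sum_l (A i j * B k l) *: cong2 (delta_mx i j) (delta_mx k l).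
Proof.
apply/lfunP=> X; rewrite sum_lfunE lfunE /= /cong_fun.
rewrite [in LHS](matrix_sum_delta A) !mulmx_suml linear_sum; apply: eq_bigr => i _.
rewrite sum_lfunE !mulmx_suml linear_sum; apply: eq_bigr => j _.
rewrite sum_lfunE [in LHS](matrix_sum_delta B) linear_sum mulmx_sumr linear_sum.
apply: eq_bigr => k _.
rewrite sum_lfunE linear_sum mulmx_sumr linear_sum; apply: eq_bigr => l _.
rewrite scale_lfunE lfunE -linearZ; congr (vsproj _ _).
have -> (c : C) : vsval (c *: X) = c *: vsval X by exact: linearZ.
by rewrite linearZ /= -!(scalemxAl, scalemxAr) scalerA mulrC.
Qed.

Lemma vdifferentiable_cong A :
  @vdifferentiable R 'M[C]_3 'End(J) (fun B => cong2 B B) A.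
Proof.
rewrite (_ : (fun B => _) = fun B => \sum_i \sum_j \sum_k \sum_l
    (B i j * B k l) *: cong2 (delta_mx i j) (delta_mx k l)); last first.
  by apply/funext => B; rewrite -cong2_sum.
do 4 apply: vdifferentiable_sum => ?.
by apply/vdifferentiableZ/sdiffM; exact: sdiff_entry.
Qed.

Lemma cong_mul A B : cong2 (A *m B) (A *m B) = (cong2 A A \o cong2 B B)%VF.
Proof.
apply/lfunP=> X; apply: val_inj; rewrite comp_lfunE /= !vsval_cong.
by rewrite trmx_mul !mulmxA.
Qed.

Lemma cong1 : cong2 1%:M 1%:M = \1%VF.
Proof.
apply/lfunP=> X; apply: val_inj.
by rewrite id_lfunE /= vsval_cong trmx1 mul1mx mulmx1.
Qed.

Lemma cong_E6 A : \det A = 1 -> @lie_carrier _ (E6RC R) (cong2 A A).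
Proof.
move=> detA; have uA : A \in unitmx by rewrite unitmxE detA unitr1.
split=> [|X]; last by rewrite /detJ vsval_cong !det_mulmx det_tr detA mul1r mulr1.
exists (cong2 (invmx A) (invmx A)) => X;
  by rewrite -comp_lfunE -cong_mul ?mulVmx ?mulmxV // cong1 id_lfunE.
Qed.

(** Precomposing with the projection extends [alpha] to all matrices, the form required by
    [det_preserver] and [congruence_root]. *)
Definition lift_sym alpha (X : 'M[C]_3) : 'M[C]_3 := vsval (alpha (proj X)).

Lemma lift_sym_linear alpha : linear (lift_sym alpha).
Proof. by move=> a X Y; rewrite /lift_sym !linearP. Qed.

Lemma lift_sym_cong A X : X^T = X -> lift_sym (cong2 A A) X = A *m X *m A^T.
Proof. by move=> sX; rewrite /lift_sym vsval_cong projK. Qed.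

(** * The congruence map is a biholomorphism *)

Lemma cong_onto alpha : @lie_carrier _ (E6RC R) alpha ->
  exists2 A, \det A = 1 & cong2 A A = alpha.
Proof.
move=> [[beta ab ba] dalpha].
pose phiL := GRing.isLinear.Build _ _ _ _ (lift_sym alpha) (lift_sym_linear alpha).
pose phi : {linear 'M[C]_3 -> 'M[C]_3} := HB.pack (lift_sym alpha) phiL.
have phiP : det_preserver phi.
  split=> [X sX | Y sY | X sX] /=.
  - exact: tr_vsval.
  - exists (vsval (beta (proj Y))); first exact: tr_vsval.
    by rewrite /lift_sym vsvalK ba projK.
  - by rewrite -[LHS]/(detJ _) dalpha /detJ projK.
have [A detA phiA] := det_preserver_congruence phiP.
exists A => //; apply/lfunP=> X; apply: val_inj.
by rewrite /= vsval_cong -phiA ?tr_vsval //= /lift_sym vsvalK.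
Qed.

(** A choice of preimage, with default value 0 where there is none. On the group the preimage is
    unique by [cong_inj], and it agrees locally with the rational [congruence_root]. *)
Definition cong_root alpha : 'M[C]_3 :=
  xget 0 [set A | \det A = 1 /\ cong2 A A = alpha].

Lemma cong_rootP alpha : @lie_carrier _ (E6RC R) alpha ->
  \det (cong_root alpha) = 1 /\ cong2 (cong_root alpha) (cong_root alpha) = alpha.
Proof.
move=> /cong_onto[A detA cA]; rewrite /cong_root.
by case: xgetP => [? -> //|/(_ A)[]].
Qed.

(** The nonvanishing of the pivot is expressed through the map alone, whose entry is
    [2 * A k i ^+ 2]; it thus defines a condition on endomorphisms. *)
Lemma congruence_root_cong A k i : \det A = 1 ->
  lift_sym (cong2 A A) (symu C i i) k k != 0 ->
  congruence_root (lift_sym (cong2 A A)) k i = A.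
Proof.
move=> detA q0; apply: congruence_rootE => //; first exact: lift_sym_cong.
apply: contraNneq q0 => Aki0.
by rewrite (congruence_pivot (A := A)) ?Aki0 ?expr0n ?mulr0 //; exact: lift_sym_cong.
Qed.

Lemma pivot_cong_neq0 A k i : A k i != 0 ->
  lift_sym (cong2 A A) (symu C i i) k k != 0.
Proof.
move=> Aki; rewrite (congruence_pivot (A := A)); last exact: lift_sym_cong.
by rewrite mulf_neq0 ?pnatr_eq0 ?expf_neq0.
Qed.

(** One rational formula, with the same pivot, recovers both [A] and [B] from the common map. *)
Lemma cong_inj A B : \det A = 1 -> \det B = 1 -> cong2 A A = cong2 B B -> A = B.
Proof.
move=> detA detB AB; have [k [i Aki]] := det1_neq0_entry detA.
have q0 := pivot_cong_neq0 Aki.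
have := congruence_root_cong detA q0; rewrite AB => <-.
by apply: congruence_root_cong; rewrite -?AB.
Qed.

Lemma cong_rootK A : \det A = 1 -> cong_root (cong2 A A) = A.
Proof. by move=> detA; have [d c] := cong_rootP (cong_E6 detA); apply: cong_inj. Qed.

Lemma sdiff_lift_sym X k l alpha :
  @sdiff R 'End(J) (fun beta => lift_sym beta X k l) alpha.
Proof.
apply: sdiff_linear => a u v.
by rewrite /lift_sym add_lfunE scale_lfunE linearP !mxE.
Qed.

Lemma holomorphic_cong_root :
  holomorphic_on (@lie_carrier _ (E6RC R)) cong_root.
Proof.
move=> alpha /cong_rootP[]; set A := cong_root alpha => detA cA.
have [k [i Aki]] := det1_neq0_entry detA.
(* [q] and [d] are the denominators of [congruence_root], with values [2 * A k i ^+ 2] and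
   [A k i ^+ 3] at [alpha]. The extension lives on the open set of endomorphisms where neither
   vanishes. *)
pose q beta := lift_sym beta (symu C i i) k k.
pose U1 := [set: 'End(J)] `&` [set beta | q beta != 0].
pose d beta := \det (pivot_mx (lift_sym beta) k i).
have spiv beta l j : q beta != 0 ->
    sdiff (fun beta => pivot_mx (lift_sym beta) k i l j) beta.
  move=> qb; pose s := lift_sym.
  apply: (@sdiff_ext _ _ (fun beta => s beta (symu C i j) k l
    - s beta (symu C i j) k k * s beta (symu C i i) k l / (2%:R * q beta))).
    by move=> y; rewrite mxE.
  apply: sdiffD; first exact: sdiff_lift_sym.
  apply/sdiffN/sdiffM; first by apply: sdiffM; exact: sdiff_lift_sym.
  apply: sdiffV; last by rewrite mulf_neq0 ?pnatr_eq0.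
  by apply: sdiffM; [exact: sdiff_cst|exact: sdiff_lift_sym].
have oU1 : vopen U1.
  by apply: vopen_neq0; [exact: vopenT|move=> *; exact: sdiff_lift_sym].
have sd beta : q beta != 0 -> sdiff d beta.
  by move=> qb; apply: sdiff_det => *; exact: spiv.
exists (U1 `&` [set beta | d beta != 0]).
exists (fun beta => congruence_root (lift_sym beta) k i).
have qA : q alpha != 0 by rewrite /q -cA pivot_cong_neq0.
split.
- by apply: vopen_neq0 => // beta [_ qb]; exact: sd.
- split=> //=; rewrite /d -cA (pivot_mxE (A := A)) //; last exact: lift_sym_cong.
  by rewrite detZ detA mulr1 expf_neq0.
- move=> beta [[_ qb] db]; apply: vdifferentiable_mx => l j.
  apply: (@sdiff_ext _ _ (fun beta =>
      q beta / 2%:R / d beta * pivot_mx (lift_sym beta) k i l j)).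
    by move=> y; rewrite [RHS]mxE.
  apply: sdiffM; last exact: spiv.
  apply: sdiffM; last by apply: sdiffV => //; exact: sd.
  by apply: sdiffM; [exact: sdiff_lift_sym|exact: sdiff_cst].
- move=> beta /cong_rootP[detB cB] [[_ qb] _].
  by rewrite -[in RHS]cB congruence_root_cong // cB.
Qed.

Lemma cong_biholomorphism :
  biholomorphism (@lie_carrier _ (SL3C R)) (@lie_carrier _ (E6RC R))
    (fun A => cong2 A A) cong_root.
Proof.
split; last exact: holomorphic_cong_root.
- by split=> [A|alpha /cong_rootP[]//]; exact: cong_E6.
- by split=> [A|alpha /cong_rootP[]//]; exact: cong_rootK.
- by apply: holomorphic_on_diff => A; exact: vdifferentiable_cong.
Qed.

Lemma E6RC_group : group_on (E6RC R).
Proof.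
(* The inverse of an element of ['End(J)] is a two-sided inverse once the kernel is zero. *)
have ker0 alpha : bijective alpha -> lker alpha == 0%VS.
  by move=> /bij_inj inj; apply/lker0P.
split=> /=.
- split=> [|a b [bija da] [bijb db]|a [bija da]].
  + by split=> [|X]; [exists id => X; rewrite id_lfunE|rewrite id_lfunE].
  + split=> [|X]; last by rewrite comp_lfunE da db.
    by apply: (eq_bij (bij_comp bija bijb)) => X; rewrite comp_lfunE.
  + have aK := lker0_lfunK (ker0 _ bija); have aVK := lker0_lfunVK (ker0 _ bija).
    by split=> [|X]; [exists a|rewrite -da aVK].
- by move=> *; exact: comp_lfunA.
- by move=> a _; rewrite comp_lfun1l comp_lfun1r.
- by move=> a [/ker0 ka _]; rewrite lker0_compVf // lker0_compfV.
Qed.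

End Congruence.

Theorem theorem4p5 (R : realType) :
  [/\ is_lie_group (E6RC R), is_lie_group (SL3C R)
    & lie_isomorphic (E6RC R) (SL3C R)].
Proof.
have bih := cong_biholomorphism R.
split; last 2 first.
- exact: SL3C_lie.
- exists (@cong_root R), (fun A => cong2 A A).
  split; first exact: biholomorphism_sym.
  (* Both elements are rewritten as congruences, whose composite is the congruence by the product of
     their roots. *)
  move=> a b Ea Eb /=; have [da ca] := cong_rootP Ea; have [db cb] := cong_rootP Eb.
  by rewrite -{1}ca -{1}cb -cong_mul cong_rootK // det_mulmx da db mulr1.
- apply: (lie_group_biholomorphism bih _ (SL3C_lie R) (E6RC_group R)).
  by move=> A B _ _; exact: cong_mul.
Qed.
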